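(* Let $A$ be a commutative Banach algebra over $\mathbb{C}$ (not assumed to have an identity). Then every maximal ideal $M$ in $A$ has codimension $1$ in $A$. Further, for each maximal ideal $M$ in $A$, either $A/M \cong \mathbb{C}$ (as algebras) or $A^2 \subset M$.
   Context: All algebras are associative, over the complex field $\mathbb{C}$, and are not assumed to have an identity. Ideals are algebra ideals (in particular linear subspaces) and are not assumed to be closed. An ideal $M$ in a commutative algebra $A$ is maximal if $M \neq A$ and if, for each ideal $I$ in $A$ with $M \subset I$, either $I = M$ or $I = A$. Maximal ideals are not assumed to be modular. For an algebra $A$, $A^2$ denotes the linear span of the set $\{ab : a, b \in A\}$. *)

(* Defs.v *)
From HB Require Import structures.
From mathcomp Require Import all_boot all_order all_algebra.
From mathcomp Require Import generic_quotient ring_quotient.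
From mathcomp Require Import all_classical all_reals all_analysis.
From mathcomp Require Import complex.

Set Implicit Arguments.
Unset Strict Implicit.
Unset Printing Implicit Defensive.

Import Order.TTheory GRing.Theory Num.Theory.
Import numFieldNormedType.Exports.

Local Open Scope classical_set_scope.
Local Open Scope ring_scope.
Local Open Scope quotient_scope.

(* The library's algebras are all unital, so the product is declared afresh. *)
HB.mixin Record Lmodule_isNonUnitalAlgebra (K : fieldType) A
    of GRing.Lmodule K A := {
  nmul : A -> A -> A;
  nmulA : associative nmul;
  nmulDl : left_distributive nmul +%R;
  nmulDr : right_distributive nmul +%R;
  nmulZl : forall (c : K) (a b : A), nmul (c *: a) b = c *: nmul a b;
  nmulZr : forall (c : K) (a b : A), nmul a (c *: b) = c *: nmul a b
}.

#[short(type="nualgType")]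
HB.structure Definition NonUnitalAlgebra (K : fieldType) :=
  {A of GRing.Lmodule K A & Lmodule_isNonUnitalAlgebra K A}.

Notation "a ** b" := (nmul a b) (at level 40, left associativity) : ring_scope.

HB.mixin Record NonUnitalAlgebra_isCommutative (K : fieldType) A
    of NonUnitalAlgebra K A := {
  nmulC : commutative (@nmul K A)
}.

#[short(type="comNualgType")]
HB.structure Definition ComNonUnitalAlgebra (K : fieldType) :=
  {A of NonUnitalAlgebra K A & NonUnitalAlgebra_isCommutative K A}.

(* Over [K = R[i]] the norm takes values in [R[i]], where [0 <= z] and
   [z <= t] force [z] and [t - z] to be real and nonnegative. *)
HB.mixin Record CompleteNormedModule_isBanachAlgebra (K : numFieldType) A
    of CompleteNormedModule K A & NonUnitalAlgebra K A := {
  norm_nmul_le : forall a b : A, `|a ** b| <= `|a| * `|b|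
}.

#[short(type="banachAlgType")]
HB.structure Definition BanachAlgebra (K : numFieldType) :=
  {A of CompleteNormedModule K A & NonUnitalAlgebra K A
      & CompleteNormedModule_isBanachAlgebra K A}.

#[short(type="comBanachAlgType")]
HB.structure Definition ComBanachAlgebra (K : numFieldType) :=
  {A of BanachAlgebra K A & NonUnitalAlgebra_isCommutative K A}.

Section RegularAlgebra.
Variable K : fieldType.

Fact regular_nmulZl (c : K) (a b : K^o) : (c *: a) * b = c *: (a * b).
Proof. by rewrite -scalerAl. Qed.

Fact regular_nmulZr (c : K) (a b : K^o) : a * (c *: b) = c *: (a * b).
Proof. by rewrite -scalerAr. Qed.

HB.instance Definition _ := Lmodule_isNonUnitalAlgebra.Build K K^o
  (@mulrA K) (@mulrDl K) (@mulrDr K) regular_nmulZl regular_nmulZr.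

End RegularAlgebra.

(* Two-sided ideals, not necessarily proper or closed. *)
HB.mixin Record isAlgIdeal (K : fieldType) (A : nualgType K) (I : A -> bool) := {
  ideal_nmull : forall a x : A, I x -> I (a ** x);
  ideal_nmulr : forall a x : A, I x -> I (x ** a)
}.

#[short(type="algIdeal")]
HB.structure Definition AlgIdeal (K : fieldType) (A : nualgType K) :=
  {I of @GRing.SubmodClosed K A I & isAlgIdeal K A I}.

Definition maximal_ideal (K : fieldType) (A : nualgType K) (M : algIdeal A) :=
  [set` M] != setT /\
  forall I : algIdeal A, [set` M] `<=` [set` I] ->
    [set` I] = [set` M] \/ [set` I] = setT.

Section QuotientAlgebra.
Variables (K : fieldType) (A : nualgType K) (M : algIdeal A).

(* The library quotients by a [zmodClosed] predicate, a structure that a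
   [submodClosed] one does not inherit; [M] is repackaged as such here. *)
Definition ideal_pred : {pred A} := M.

Fact ideal_pred_zmod_closed : zmod_closed ideal_pred.
Proof.
split=> [|x y Mx My]; first exact: (@rpred0 _ M).
by rewrite -scaleN1r; apply: (@rpredD _ M) => //; exact: (@rpredZ _ _ M).
Qed.

HB.instance Definition _ :=
  GRing.isZmodClosed.Build A ideal_pred ideal_pred_zmod_closed.

Definition alg_quot : Type := Quotient.quot ideal_pred.

HB.instance Definition _ := GRing.Zmodule.on alg_quot.
HB.instance Definition _ := generic_quotient.Quotient.on alg_quot.

Implicit Types (c d : K) (a b x y : A) (u v w : alg_quot).

Let Q_eqP x y : reflect (\pi_alg_quot x = \pi_alg_quot y) (x - y \in M).
Proof. by rewrite (Quotient.idealrBE ideal_pred); apply: eqP. Qed.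

Let reprB x : repr (\pi_alg_quot x) - x \in M.
Proof. by apply/Q_eqP; rewrite reprK. Qed.

Let Q_piD x y : \pi_alg_quot (x + y) = \pi_alg_quot x + \pi_alg_quot y.
Proof. exact: (Quotient.pi_add ideal_pred). Qed.

Definition quot_scale c u : alg_quot := \pi_alg_quot (c *: repr u).
Definition quot_mul u v : alg_quot := \pi_alg_quot (repr u ** repr v).

Lemma pi_quot_scale c x : \pi_alg_quot (c *: x) = quot_scale c (\pi_alg_quot x).
Proof.
by apply/esym/Q_eqP; rewrite -scalerBr (@rpredZ _ _ M) // reprB.
Qed.

Lemma pi_quot_mul x y :
  \pi_alg_quot (x ** y) = quot_mul (\pi_alg_quot x) (\pi_alg_quot y).
Proof.
apply/esym/Q_eqP; set x' := repr _; set y' := repr _.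
have nmulN a b : a ** (- b) = - (a ** b) by rewrite -scaleN1r nmulZr scaleN1r.
have nNmul a b : (- a) ** b = - (a ** b) by rewrite -scaleN1r nmulZl scaleN1r.
have -> : x' ** y' - x ** y = (x' - x) ** y' + x ** (y' - y).
  by rewrite nmulDl nmulDr nmulN nNmul addrA subrK.
by apply: (@rpredD _ M); [apply: ideal_nmulr | apply: ideal_nmull]; exact: reprB.
Qed.

Let quot_ind (P : alg_quot -> Prop) : (forall x, P (\pi_alg_quot x)) -> forall u, P u.
Proof. by move=> Ppi u; rewrite -[u]reprK. Qed.

Fact quot_scaleA c d u : quot_scale c (quot_scale d u) = quot_scale (c * d) u.
Proof. by elim/quot_ind: u => x; rewrite -!pi_quot_scale scalerA. Qed.

Fact quot_scale1 : left_id 1 quot_scale.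
Proof. by elim/quot_ind => x; rewrite -pi_quot_scale scale1r. Qed.

Fact quot_scaleDr : right_distributive quot_scale +%R.
Proof.
move=> c; elim/quot_ind => x; elim/quot_ind => y.
by rewrite -(Q_piD x y) -!pi_quot_scale -Q_piD scalerDr.
Qed.

Fact quot_scaleDl u : {morph quot_scale^~ u : c d / c + d}.
Proof.
move=> c d /=; elim/quot_ind: u => x.
by rewrite -!pi_quot_scale -Q_piD scalerDl.
Qed.

HB.instance Definition _ := GRing.Zmodule_isLmodule.Build K alg_quot
  quot_scaleA quot_scale1 quot_scaleDr quot_scaleDl.

Fact quot_mulA : associative quot_mul.
Proof.
elim/quot_ind => x; elim/quot_ind => y; elim/quot_ind => z.
by rewrite -!pi_quot_mul nmulA.
Qed.

Fact quot_mulDl : left_distributive quot_mul +%R.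
Proof.
elim/quot_ind => x; elim/quot_ind => y; elim/quot_ind => z.
by rewrite -(Q_piD x y) -!pi_quot_mul -Q_piD nmulDl.
Qed.

Fact quot_mulDr : right_distributive quot_mul +%R.
Proof.
elim/quot_ind => x; elim/quot_ind => y; elim/quot_ind => z.
by rewrite -(Q_piD y z) -!pi_quot_mul -Q_piD nmulDr.
Qed.

Fact quot_mulZl c u v : quot_mul (c *: u) v = c *: quot_mul u v.
Proof.
elim/quot_ind: u => x; elim/quot_ind: v => y.
by rewrite /GRing.scale /= -pi_quot_scale -!pi_quot_mul -pi_quot_scale nmulZl.
Qed.

Fact quot_mulZr c u v : quot_mul u (c *: v) = c *: quot_mul u v.
Proof.
elim/quot_ind: u => x; elim/quot_ind: v => y.
by rewrite /GRing.scale /= -pi_quot_scale -!pi_quot_mul -pi_quot_scale nmulZr.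
Qed.

HB.instance Definition _ := Lmodule_isNonUnitalAlgebra.Build K alg_quot
  quot_mulA quot_mulDl quot_mulDr quot_mulZl quot_mulZr.

End QuotientAlgebra.

Definition has_dim (K : fieldType) (V : lmodType K) (n : nat) : Prop :=
  exists e : 'I_n -> V,
    forall v : V, exists! c : 'rV[K]_n, v = \sum_(i < n) c 0 i *: e i.

Definition has_codim (K : fieldType) (A : nualgType K) (M : algIdeal A)
  (n : nat) : Prop := has_dim (alg_quot M) n.

Definition alg_isomorphic (K : fieldType) (A B : nualgType K) : Prop :=
  exists f : {linear A -> B}, {morph f : a b / a ** b} /\ bijective f.

Definition linear_span (K : fieldType) (V : lmodType K) (S : set V) : set V :=
  [set v | exists (n : nat) (c : 'I_n -> K) (s : 'I_n -> V),
     (forall i, S (s i)) /\ v = \sum_(i < n) c i *: s i].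

Definition alg_square (K : fieldType) (A : nualgType K) : set A :=
  linear_span [set x | exists a b : A, x = a ** b].
Arguments alg_square {K} A _.

(* Main.v *)
Require Import Defs.
From HB Require Import structures.
From mathcomp Require Import all_boot all_order all_algebra.
From mathcomp Require Import generic_quotient ring_quotient.
From mathcomp Require Import all_classical all_reals all_analysis.
From mathcomp Require Import complex ring lra.

(** Let [M] be a maximal ideal.  If [M] contains all products, every linear
subspace containing [M] is an ideal, so maximality forces codimension [1]
([square_codim1]).  Otherwise the elements [a] with [a ** A] inside [M] form an
ideal containing [M] but different from [A], hence equal to [M]; so for each
[a] outside [M] the ideal [a ** A + M] is strictly larger than [M], that is,
equal to [A].  Thus division by [a] is possible modulo [M], and [A / M] is a
field ([maximal_quotient_field]); in particular [M] is modular.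

It remains to see that this field is [C], and that is the Gelfand-Mazur
theorem.  The quotient seminorm, an infimum of norms of lifts, makes [A / M] a
seminormed field.  It is not identically [0], because a lift [x] of the
identity cannot have norm less than [1]: by completeness the series
[x + x^2 + x^3 + ...] would converge to some [y] with [y = x + x ** y], and
reading this equation modulo [M] gives [1 = 0] ([quasi_inverse],
[quot_norm_unit_ge1]).

Gelfand-Mazur itself ([gelfand_mazur]) is proved for a field [F] containing [C]
and a submultiplicative seminorm that does not kill [1], with means over roots
of unity in place of contour integrals.  Let [a] in [F] be outside [C].  The resolvent
[z |-> (a - z)^-1] is then defined on the whole plane, locally bounded, and
tends to [0] at infinity, so it is bounded by some [B], and by the resolvent
identity it is [B^2]-Lipschitz.  For [N = 2^k], the mean of [a / (a - z)] over
the [N]-th roots [z] of [r^N] is [a^N / (a^N - r^N)].  Means inherit the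
Lipschitz bound as functions of [r], uniformly in [N].  If [(r/a)^N] is small for
all large [N], then these means are near [1] at [r], hence not far from [1] at
[r + 2 delta], where [delta] depends only on [B] and [a]; solving for the power
shows that [((r + 2 delta)/a)^N] stays bounded, and so [((r + delta)/a)^N] tends
to [0].  Starting from [r = 0], induction gives means near [1] on arbitrarily
large circles ([relative_power_step]), whereas there they are near [0], since
the resolvent is ([circle_mean_far]). *)

Set Implicit Arguments.
Unset Strict Implicit.
Unset Printing Implicit Defensive.

Import Order.TTheory GRing.Theory Num.Theory.
Import numFieldNormedType.Exports.
Import ComplexField.Normc.

Local Open Scope classical_set_scope.
Local Open Scope ring_scope.
Local Open Scope complex_scope.

(** * The modulus on R[i] *)

Section ComplexModulus.
Variable R : realType.
Implicit Types z w : R[i].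

Lemma normc_ge0 z : 0 <= normc z.
Proof. by case: z => x y; exact: Num.Theory.sqrtr_ge0. Qed.

Lemma normc_real (x : R) : 0 <= x -> normc x%:C = x.
Proof. by move=> x0; rewrite /= expr0n /= addr0 sqrtr_sqr ger0_norm. Qed.

Lemma normcX z n : normc (z ^+ n) = normc z ^+ n.
Proof.
elim: n => [|n IH]; first by rewrite !expr0 normc1.
by rewrite !exprS normcM IH.
Qed.

Lemma normc_le_ReIm z : normc z <= `|complex.Re z| + `|complex.Im z|.
Proof.
case: z => x y /=; rewrite -(@ger0_norm _ (`|x| + `|y|)) ?addr_ge0 //.
rewrite -sqrtr_sqr ler_wsqrtr // sqrrD !real_normK ?num_real //.
by rewrite lerD2r lerDl mulrn_wge0 // mulr_ge0.
Qed.

Lemma Re_Im_le_normc z : (`|complex.Re z| <= normc z) /\ (`|complex.Im z| <= normc z).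
Proof.
by case: z => x y /=; split; rewrite -sqrtr_sqr ler_wsqrtr // ?lerDl ?lerDr sqr_ge0.
Qed.

(** Heine-Borel in the plane.  Passing to real and imaginary parts, the disc
lies in a compact square, which is covered by the sets on which [g] is bounded
by one and the same constant. *)
Lemma locally_bounded_disc (g : R[i] -> R) :
  (forall w, exists2 d, 0 < d &
     exists C, forall z, normc (z - w) < d -> g z <= C) ->
  forall T, exists B, forall z, normc z <= T -> g z <= B.
Proof.
move=> gloc T.
have /compact_near_coveringP cpt :
    compact (`[- T, T]%classic `*` `[- T, T]%classic : set (R * R)).
  by apply: compact_setX; exact: segment_compact.
have [|B [_ gB]] :=
    cpt R (+oo) (fun B p => g (p.1 +i* p.2) <= B) _.
  move=> [x y] _; have [d d0 [C gC]] := gloc (x +i* y).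
  exists (ball (x, y) (d / 2), `]C, +oo[%classic).
    split; last by exists C; split=> [|b]; rewrite ?num_real //= in_itv /= andbT.
    by apply: nbhsx_ballx; rewrite divr_gt0.
  move=> [[x' y'] b] /= [[bx byy]]; rewrite in_itv /= andbT => Cb.
  apply: le_trans (ltW Cb); apply: gC.
  apply: le_lt_trans (normc_le_ReIm _) _ => /=.
  move: bx byy; rewrite /ball /= => bx byy.
  by rewrite [ltRHS]splitr ltrD // distrC.
(* The bound holds for all parameters strictly larger than [B]. *)
exists (B + 1) => z zT; case: z zT => x y zT.
have [/= xT yT] := Re_Im_le_normc (x +i* y).
have := gB (B + 1) (ltr_pwDr ltr01 (lexx B)).
by move=> /(_ (x, y)) /=; apply; split; rewrite /= in_itv /= -ler_norml;
   apply: le_trans zT.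
Qed.

End ComplexModulus.

(** * The Gelfand-Mazur theorem *)

(** The map [f] plays the role of the inclusion of the scalars.  A
submultiplicative [nu] vanishing at [1] would vanish everywhere, so positivity at
[1] excludes exactly the zero seminorm. *)
Record algebra_seminorm (R : realType) (F : fieldType)
    (f : {rmorphism R[i] -> F}) (nu : F -> R) : Prop := {
  nu_ge0 : forall x, 0 <= nu x;
  nuD : forall x y, nu (x + y) <= nu x + nu y;
  nuM : forall x y, nu (x * y) <= nu x * nu y;
  nuZ : forall c x, nu (f c * x) <= normc c * nu x;
  nu1_gt0 : 0 < nu 1
}.

Section GelfandMazur.
Variables (R : realType) (F : fieldType) (f : {rmorphism R[i] -> F}).
Variables (nu : F -> R) (nuP : algebra_seminorm f nu).
Implicit Types (x y u : F) (z w : R[i]).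

Let ge0 := nu_ge0 nuP.

Lemma nu0 : nu 0 = 0.
Proof.
apply/eqP; rewrite eq_le ge0 andbT.
by have := nuZ nuP 0 0; rewrite mulr0 normc0 mul0r.
Qed.

Lemma nuN x : nu (- x) = nu x.
Proof.
have nuNle y : nu (- y) <= nu y.
  have := nuZ nuP (- 1) y; rewrite rmorphN1 mulN1r => /le_trans; apply.
  by rewrite normcN normc1 mul1r.
by apply/eqP; rewrite eq_le nuNle -{1}(opprK x) nuNle.
Qed.

Lemma nu1_ge1 : 1 <= nu 1.
Proof.
have nu1 := nu1_gt0 nuP.
by have := nuM nuP 1 1; rewrite mulr1 ler_pMr.
Qed.

(** Geometric-series estimate in implicit form: [x = (1 - y)^-1 * u], so [2] is
the value of [(1 - 1/2)^-1].  All bounds on inverses below come from it. *)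
Lemma nu_fixpoint x u y : x = u + y * x -> nu y <= 2^-1 -> nu x <= 2 * nu u.
Proof.
move=> xE y_le.
have : nu x <= nu u + nu y * nu x.
  by rewrite {1}xE (le_trans (nuD nuP _ _)) // lerD2l (nuM nuP).
have : nu y * nu x <= 2^-1 * nu x by rewrite ler_wpM2r.
lra.
Qed.

Section NoEigenvalue.
Variables (a : F) (a_res : forall z, a - f z != 0).

Definition resolvent z := (a - f z)^-1.

(** From [(a - z) * x = 1] one gets [x = - z^-1 + z^-1 * a * x], and the factor
[z^-1 * a] is small when [z] is large compared with [a]. *)
Lemma resolvent_far z : z != 0 -> 2 * nu a <= normc z ->
  nu (resolvent z) <= 2 * (nu 1 / normc z).
Proof.
move=> z0 zfar.
have nz_gt0 : 0 < normc z.
  rewrite lt_def normc_ge0 andbT; apply: contra z0 => /eqP zE.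
  by rewrite (eq0_normc zE).
have fz0 : f z != 0 by rewrite fmorph_eq0.
have := @nu_fixpoint (resolvent z) (f (- z^-1) * 1) (f z^-1 * a).
move=> /(_ _ _)/le_trans; apply.
- rewrite rmorphN fmorphV /resolvent; have := a_res z => az0; field.
  by rewrite az0.
- apply: le_trans (nuZ nuP _ _) _; rewrite normcV mulrC ler_pdivrMr //.
  lra.
- rewrite ler_pM2l // (le_trans (nuZ nuP _ _)) // normcN normcV.
  by rewrite mulrC.
Qed.

(** The resolvent identity writes [resolvent z] as [resolvent w] plus a small
multiple of [resolvent z]. *)
Lemma resolvent_locally_bounded w : exists2 d, 0 < d &
  exists C, forall z, normc (z - w) < d -> nu (resolvent z) <= C.
Proof.
have c_gt0 : 0 < 2 * (nu (resolvent w) + 1) by rewrite mulr_gt0 // ltr_wpDl.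
exists (2 * (nu (resolvent w) + 1))^-1; first by rewrite invr_gt0.
exists (2 * nu (resolvent w)) => z zw.
apply: (@nu_fixpoint _ _ (f (z - w) * resolvent w)).
  rewrite rmorphB /resolvent; have := a_res z; have := a_res w => aw0 az0.
  by field; rewrite aw0 az0.
apply: le_trans (nuZ nuP _ _) _.
have : normc (z - w) * nu (resolvent w) <=
    (2 * (nu (resolvent w) + 1))^-1 * nu (resolvent w).
  by rewrite ler_wpM2r // ltW.
move=> /le_trans; apply; rewrite mulrC ler_pdivrMr //; lra.
Qed.

Lemma resolvent_bounded : exists2 B, 0 <= B &
  forall z, nu (resolvent z) <= B.
Proof.
have [B BP] := locally_bounded_disc resolvent_locally_bounded (2 * nu a + 1).
exists (`|B| + 2 * nu 1) => [|z]; first by rewrite addr_ge0 // mulr_ge0.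
(* Adding [1] to the radius forces [1 <= normc z] outside, where
   [resolvent_far] then gives the bound [2 * nu 1]. *)
have [znear|/ltW zfar] := leP (normc z) (2 * nu a + 1).
  rewrite (le_trans (BP _ znear)) // (le_trans (ler_norm B)) // lerDl.
  by rewrite mulr_ge0.
have nz_ge1 : 1 <= normc z by rewrite (le_trans _ zfar) // lerDr mulr_ge0.
have z0 : z != 0.
  by apply: contraTneq nz_ge1 => ->; rewrite normc0 -ltNge.
apply: le_trans (resolvent_far z0 _) _; first by lra.
rewrite -[leLHS]add0r lerD // ler_pM2l // ler_pdivrMr ?(lt_le_trans ltr01) //.
by rewrite ler_peMr.
Qed.

(** This is the mean of [a / (a - f z)] over the [2 ^ k] roots [z] of
[z ^+ (2 ^ k) = w].  Exponents are restricted to powers of [2] so that properties of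
means follow by repeated halving ([circle_mean_double]), without summing over
roots of unity. *)
Definition circle_mean k w := a ^+ (2 ^ k) / (a ^+ (2 ^ k) - f w).

Lemma circle_mean0 w : circle_mean 0 w = a * resolvent w.
Proof. by rewrite /circle_mean expn0 expr1. Qed.

(** Taking square roots, [a ^+ 2N - w] splits into two factors of the same form
of exponent [N], down to [a - f z]. *)
Lemma pow_resolvent k w : a ^+ (2 ^ k) - f w != 0.
Proof.
elim: k w => [|k IH] w; first by rewrite expn0 expr1.
rewrite -[w]sqrtCK rmorphXn expnSr exprM subr_sqr mulf_neq0 ?IH //.
by rewrite -[f _]opprK -rmorphN IH.
Qed.

Lemma a_neq0 : a != 0.
Proof. by have := a_res 0; rewrite rmorph0 subr0. Qed.

(** The partial fraction identity
[x^2 / (x^2 - w^2) = (x / (x - w) + x / (x + w)) / 2]. *)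
Lemma circle_mean_double k w :
  circle_mean k.+1 (w ^+ 2) =
  f 2^-1 * (circle_mean k w + circle_mean k (- w)).
Proof.
have := pow_resolvent k w; have := pow_resolvent k (- w).
have := pow_resolvent k.+1 (w ^+ 2).
rewrite /circle_mean expnSr exprM; set x := a ^+ _.
rewrite fmorphV rmorph_nat rmorphN rmorphXn opprK.
have : 2%:R != 0 :> F by rewrite -(rmorph_nat f) fmorph_eq0 pnatr_eq0.
by move=> n2 n3 n4 n5; field; rewrite n2 n3 n4 n5.
Qed.

Lemma nu_half_sum x y C : nu x <= C -> nu y <= C -> nu (f 2^-1 * (x + y)) <= C.
Proof.
move=> xC yC; apply: le_trans (nuZ nuP _ _) _.
have -> : normc (2^-1 : R[i]) = 2^-1.
  by rewrite normcV -[2](rmorph_nat (real_complex R)) normc_real.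
have := nuD nuP x y; lra.
Qed.

(** Halving replaces the circle of radius [T ^+ 2N] by that of radius [T ^+ N], and
an average of two elements of seminorm at most [C] is again one. *)
Lemma circle_mean_far T C k w : 0 <= T ->
    (forall z, T <= normc z -> nu (a * resolvent z) <= C) ->
  T ^+ (2 ^ k) <= normc w -> nu (circle_mean k w) <= C.
Proof.
move=> T0 TC; elim: k w => [|k IH] w; first by rewrite circle_mean0; exact: TC.
rewrite -[w]sqrtCK circle_mean_double normcX expnSr exprM ler_sqr ?nnegrE.
  by move=> Tw; apply: nu_half_sum; apply: IH; rewrite ?normcN.
  exact: exprn_ge0.
exact: normc_ge0.
Qed.

(** The unimodular factor [z] is what makes the induction on [k] go through:
halving replaces it by its two square roots and leaves [r] and [s] alone.  The
constant is independent of [k]. *)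
Lemma circle_mean_lipschitz B k z r s : 0 <= B ->
    (forall z, nu (resolvent z) <= B) -> normc z = 1 ->
  nu (circle_mean k (z * r ^+ (2 ^ k)) - circle_mean k (z * s ^+ (2 ^ k)))
  <= nu a * B ^+ 2 * normc (r - s).
Proof.
move=> B0 BP; elim: k z => [|k IH] z z1.
  rewrite !circle_mean0 expn0 !expr1.
  have -> : a * resolvent (z * r) - a * resolvent (z * s) =
      f (z * (r - s)) * (a * (resolvent (z * r) * resolvent (z * s))).
    have := a_res (z * r); have := a_res (z * s).
    rewrite /resolvent mulrBr rmorphB; move: (f _) (f _) => fs fr n1 n2.
    by field; rewrite n1 n2.
  apply: le_trans (nuZ nuP _ _) _; rewrite normcM z1 mul1r mulrC ler_wpM2r //.
    exact: normc_ge0.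
  apply: le_trans (nuM nuP _ _) _; rewrite ler_wpM2l //.
  by apply: le_trans (nuM nuP _ _) _; rewrite expr2 ler_pM.
(* Pair each square root of [z * r ^+ (2 ^ k.+1)] with the corresponding one for
   [s]: the roots with factor [sqrtC z], and those with factor [- sqrtC z]. *)
have sz1 : normc (sqrtC z) = 1.
  have : normc (sqrtC z) ^+ 2 == 1 by rewrite -normcX sqrtCK z1.
  by rewrite sqrf_eq1 => /predU1P[//|/eqP szN]; have := normc_ge0 (sqrtC z);
    rewrite szN; lra.
have sE t : z * t ^+ (2 ^ k.+1) = (sqrtC z * t ^+ (2 ^ k)) ^+ 2.
  by rewrite exprMn sqrtCK expnSr exprM.
rewrite !sE !circle_mean_double -mulrBr.
rewrite (_ : _ + _ - (_ + _) =
  (circle_mean k (sqrtC z * r ^+ (2 ^ k)) - circle_mean k (sqrtC z * s ^+ (2 ^ k)))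
  + (circle_mean k (- sqrtC z * r ^+ (2 ^ k)) -
     circle_mean k (- sqrtC z * s ^+ (2 ^ k)))); last by rewrite !mulNr; ring.
by apply: nu_half_sum; apply: IH; rewrite ?normcN.
Qed.

Definition relative_power k (r : R) := nu (f (r%:C ^+ (2 ^ k)) / a ^+ (2 ^ k)).

(** With [v = f w / a ^+ (2 ^ k)] the mean is [(1 - v)^-1], so it differs from
[1] by [v * (1 - v)^-1], at most [2 * nu 1 * nu v]. *)
Lemma circle_mean_near1 k w : nu (f w / a ^+ (2 ^ k)) <= (8 * nu 1)^-1 ->
  nu (circle_mean k w - 1) <= 4^-1.
Proof.
have nu1 := nu1_gt0 nuP; have nu1_1 := nu1_ge1.
have aN0 : a ^+ (2 ^ k) != 0 by rewrite expf_neq0 // a_neq0.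
have aw0 := pow_resolvent k w => small.
have mE : circle_mean k w = 1 + f w / a ^+ (2 ^ k) * circle_mean k w.
  by rewrite /circle_mean; field; rewrite aN0 aw0.
have half : nu (f w / a ^+ (2 ^ k)) <= 2^-1.
  apply: le_trans small _; rewrite lef_pV2 ?posrE //; lra.
have mle := nu_fixpoint mE half.
rewrite {1}mE [1 + _]addrC addrK (le_trans (nuM nuP _ _)) //.
apply: le_trans (ler_pM (ge0 _) (ge0 _) small mle) _.
by rewrite mulrC ler_pdivrMr; lra.
Qed.

(** The converse direction: [f w / a ^+ (2 ^ k)] is [1] minus the inverse of the
mean, and an element close to [1] has an inverse of seminorm at most [2 * nu 1]. *)
Lemma scaled_power_bound k w : nu (circle_mean k w - 1) <= 2^-1 ->
  nu (f w / a ^+ (2 ^ k)) <= 3 * nu 1.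
Proof.
have aN0 : a ^+ (2 ^ k) != 0 by rewrite expf_neq0 // a_neq0.
have aw0 := pow_resolvent k w; rewrite -nuN opprB => half.
set v := (circle_mean k w)^-1.
have vE : v = 1 + (1 - circle_mean k w) * v.
  by rewrite /v /circle_mean; field; rewrite aN0 aw0.
have -> : f w / a ^+ (2 ^ k) = 1 - v.
  by rewrite /v /circle_mean; field; rewrite aN0 aw0.
apply: le_trans (nuD nuP _ _) _; rewrite nuN.
have := nu_fixpoint vE half; lra.
Qed.

Lemma relative_power_le k (r s : R) : 0 <= r -> 0 < s ->
  relative_power k r <= (r / s) ^+ (2 ^ k) * relative_power k s.
Proof.
move=> r0 s0; rewrite /relative_power.
have -> : r%:C ^+ (2 ^ k) = (r / s)%:C ^+ (2 ^ k) * s%:C ^+ (2 ^ k).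
  by rewrite -exprMn -rmorphM divfK // gt_eqF.
rewrite rmorphM -mulrA; apply: le_trans (nuZ nuP _ _) _.
by rewrite normcX normc_real // divr_ge0 // ltW.
Qed.

(** The Lipschitz constant is written [(8 * delta)^-1] so that moving the radius by
[2 * delta] changes a mean by at most [1/4].  The radius is moved twice as far as
the conclusion asks: at [r + 2 * delta] the powers are only bounded, and the
ratio [q < 1] of the two radii turns boundedness into decay at [r + delta]. *)
Lemma relative_power_step (delta r : R) :
    (forall k r s, nu (circle_mean k (r ^+ (2 ^ k)) - circle_mean k (s ^+ (2 ^ k)))
       <= (8 * delta)^-1 * normc (r - s)) ->
    0 < delta -> 0 <= r ->
    (\forall k \near \oo, relative_power k r <= (8 * nu 1)^-1) ->
  \forall k \near \oo, relative_power k (r + delta) <= (8 * nu 1)^-1.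
Proof.
move=> lip d0 r0 Sr; have nu1 := nu1_gt0 nuP.
set q := (r + delta) / (r + 2 * delta).
have s0 : 0 < r + 2 * delta by lra.
have q0 : 0 <= q by rewrite divr_ge0; lra.
have q1 : `|q| < 1 by rewrite ger0_norm // ltr_pdivrMr //; lra.
have c0 : 0 < (8 * nu 1)^-1 / (3 * nu 1) by rewrite divr_gt0 ?invr_gt0; lra.
have qsmall : \forall k \near \oo, q ^+ k <= (8 * nu 1)^-1 / (3 * nu 1).
  have /cvgrPdist_le/(_ _ c0) := cvg_expr q1; apply: filterS => k.
  by rewrite sub0r normrN ger0_norm // exprn_ge0.
near=> k.
have rk : relative_power k r <= (8 * nu 1)^-1 by near: k.
have qk : q ^+ k <= (8 * nu 1)^-1 / (3 * nu 1) by near: k.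
have m1 := circle_mean_near1 rk.
have m2 : nu (circle_mean k ((r + 2 * delta)%:C ^+ (2 ^ k)) - 1) <= 2^-1.
  have -> : circle_mean k ((r + 2 * delta)%:C ^+ (2 ^ k)) - 1 =
    (circle_mean k ((r + 2 * delta)%:C ^+ (2 ^ k)) - circle_mean k (r%:C ^+ (2 ^ k)))
    + (circle_mean k (r%:C ^+ (2 ^ k)) - 1) by ring.
  have := lip k (r + 2 * delta)%:C r%:C.
  have -> : (r + 2 * delta)%:C - r%:C = (2 * delta)%:C.
    by rewrite -(rmorphB (real_complex R)) addrAC subrr add0r.
  rewrite normc_real; last by lra.
  rewrite (_ : (8 * delta)^-1 * (2 * delta) = 4^-1); last first.
    by field; rewrite gt_eqF.
  by move=> m3; apply: le_trans (nuD nuP _ _) _; lra.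
have rd0 : 0 <= r + delta by lra.
apply: le_trans (relative_power_le k rd0 s0) _.
have qN : q ^+ (2 ^ k) <= (8 * nu 1)^-1 / (3 * nu 1).
  apply: le_trans qk; rewrite ler_wiXn2l ?(ltnW (ltn_expl _ _)) //.
  by rewrite ltW // -(ger0_norm q0).
apply: le_trans (ler_pM _ _ qN (scaled_power_bound m2)) _ => //.
- exact: exprn_ge0.
- by rewrite divfK // gt_eqF //; lra.
Unshelve. all: by end_near. Qed.

End NoEigenvalue.

(** Only finitely many steps of size [delta] separate the circle of radius [0],
where the means are [1], from circles on which they have seminorm at most [1/4];
since [nu 1 >= 1], both cannot hold at once. *)
Theorem gelfand_mazur a : exists c, a = f c.
Proof.
apply: contrapT => no_c.
have a_res z : a - f z != 0.
  by rewrite subr_eq0; apply/eqP => az; apply: no_c; exists z.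
have nu1 := nu1_gt0 nuP; have nu1_1 := nu1_ge1.
have [B B0 BP] := resolvent_bounded a_res.
pose L := nu a * B ^+ 2 + 1.
have L0 : 0 < L by rewrite ltr_wpDl // mulr_ge0 // exprn_ge0.
pose delta := (8 * L)^-1.
have d0 : 0 < delta by rewrite invr_gt0; lra.
have lip k r s :
    nu (circle_mean a k (r ^+ (2 ^ k)) - circle_mean a k (s ^+ (2 ^ k)))
    <= (8 * delta)^-1 * normc (r - s).
  have -> : (8 * delta)^-1 = L by rewrite /delta; field; rewrite gt_eqF.
  have := circle_mean_lipschitz a_res k r s B0 BP (normc1 R).
  rewrite !mul1r => /le_trans; apply.
  by rewrite ler_wpM2r ?normc_ge0 // lerDl.
have S n : \forall k \near \oo,
    relative_power a k (n%:R * delta) <= (8 * nu 1)^-1.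
  elim: n => [|n IH].
    apply: nearW => k; rewrite mul0r /relative_power.
    rewrite expr0n expn_eq0 /= rmorph0 mul0r nu0 invr_ge0; lra.
  rewrite -[n.+1]addn1 natrD mulrDl mul1r.
  by apply: relative_power_step => //; rewrite mulr_ge0 // ltW.
(* The first summand puts us in the range of [resolvent_far]; the second makes its
   bound, multiplied by [nu a], at most [1/4]. *)
pose T := 2 * nu a + 8 * nu a * nu 1 + 1.
have T0 : 0 < T by rewrite ltr_wpDl // addr_ge0 ?mulr_ge0 // ltW.
have far z : T <= normc z -> nu (a * resolvent a z) <= 4^-1.
  move=> Tz; have nz0 := lt_le_trans T0 Tz.
  have z0 : z != 0 by apply: contraTneq nz0 => ->; rewrite normc0 ltxx.
  have anu1 : 0 <= nu a * nu 1 by rewrite mulr_ge0.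
  apply: le_trans (nuM nuP _ _) _.
  have /(ler_wpM2l (ge0 a))/le_trans : nu (resolvent a z) <= 2 * (nu 1 / normc z).
    by apply: resolvent_far => //; rewrite /T in Tz; lra.
  apply; rewrite !mulrA ler_pdivrMr // /T in Tz *; have := ge0 a; lra.
have [n Tn] : exists n, T <= n%:R * delta.
  exists (Num.bound (T / delta)); rewrite -ler_pdivrMr //.
  by apply/ltW/archi_boundP; rewrite divr_ge0 ?ltW.
have [k _ /(_ k (leqnn k)) /= /(circle_mean_near1 a_res) near1] := S n.
have small : nu (circle_mean a k ((n%:R * delta)%:C ^+ (2 ^ k))) <= 4^-1.
  apply: circle_mean_far (ltW T0) far _ => //.
  have nd0 : 0 <= n%:R * delta by rewrite mulr_ge0 // ltW.
  by rewrite normcX normc_real // lerXn2r ?nnegrE // ltW.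
have := nuD nuP (circle_mean a k ((n%:R * delta)%:C ^+ (2 ^ k)))
  (- (circle_mean a k ((n%:R * delta)%:C ^+ (2 ^ k)) - 1)).
rewrite nuN opprB addrC subrK; lra.
Qed.

End GelfandMazur.

(** * Non-unital algebras and quotients by ideals *)

Section NonUnital.
Variables (K : fieldType) (A : nualgType K).
Implicit Types (a b : A) (c : K).

Lemma nmul0 a : a ** 0 = 0.
Proof. by rewrite -[X in _ ** X](scale0r (0 : A)) nmulZr scale0r. Qed.

Lemma nmulN a b : a ** (- b) = - (a ** b).
Proof. by rewrite -scaleN1r nmulZr scaleN1r. Qed.

Lemma nmulBr a b b' : a ** (b - b') = a ** b - a ** b'.
Proof. by rewrite nmulDr nmulN. Qed.

(** Ideals come with a boolean predicate; classical logic supplies it for an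
arbitrary set. *)
Lemma ideal_of_set (P : set A) :
  P 0 -> (forall a b, P a -> P b -> P (a + b)) ->
  (forall c a, P a -> P (c *: a)) ->
  (forall a b, P b -> P (a ** b)) -> (forall a b, P b -> P (b ** a)) ->
  exists I : algIdeal A, [set` I] = P.
Proof.
move=> P0 PD PZ Pl Pr.
pose p a : bool := `[< P a >].
have pP : submod_closed (p : {pred A}).
  split=> [|c a b /asboolP Pa /asboolP Pb]; apply/asboolP => //.
  by apply: PD => //; exact: PZ.
have pl a b : p b -> p (a ** b) by move=> /asboolP Pb; apply/asboolP; exact: Pl.
have pr a b : p b -> p (b ** a) by move=> /asboolP Pb; apply/asboolP; exact: Pr.
pose I : algIdeal A := HB.pack p (GRing.isSubmodClosed.Build K A p pP)
  (isAlgIdeal.Build K A p pl pr).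
by exists I; apply/seteqP; split=> a /= => [/asboolP|Pa]; last exact/asboolP.
Qed.

Variable M : algIdeal A.

Lemma idealD a b : a \in M -> b \in M -> a + b \in M.
Proof. exact: (@rpredD _ M). Qed.

Lemma idealZ c a : a \in M -> c *: a \in M.
Proof. exact: (@rpredZ _ _ M). Qed.

Lemma ideal0 : 0 \in M.
Proof. exact: (@rpred0 _ M). Qed.

Lemma idealMl a b : b \in M -> a ** b \in M.
Proof. exact: (@ideal_nmull _ _ M). Qed.

Lemma idealMr a b : b \in M -> b ** a \in M.
Proof. exact: (@ideal_nmulr _ _ M). Qed.

Definition qproj a : alg_quot M := \pi_(alg_quot M)%qT a.

Lemma qprojD a b : qproj (a + b) = qproj a + qproj b.
Proof. exact: (Quotient.pi_add (ideal_pred M)). Qed.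

Lemma qprojZ c a : qproj (c *: a) = c *: qproj a.
Proof. exact: pi_quot_scale. Qed.

Lemma qprojM a b : qproj (a ** b) = qproj a ** qproj b.
Proof. exact: pi_quot_mul. Qed.

Lemma qproj_surj (q : alg_quot M) : exists a, qproj a = q.
Proof. by exists (repr q); rewrite /qproj reprK. Qed.

Lemma qproj_eq a b : qproj a = qproj b <-> a - b \in M.
Proof.
split=> [/eqP ab|ab].
  by have := ab; rewrite -(Quotient.idealrBE (ideal_pred M)).
by apply/eqP; rewrite -(Quotient.idealrBE (ideal_pred M)).
Qed.

Lemma qproj_eq0 a : qproj a = 0 <-> a \in M.
Proof.
have <- : qproj 0 = 0 by rewrite -(scale0r (0 : A)) qprojZ scale0r.
by rewrite qproj_eq subr0.
Qed.

End NonUnital.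

Lemma has_dim1 (K : fieldType) (V : lmodType K) (u : V) :
  u != 0 -> (forall v, exists c : K, v = c *: u) -> has_dim V 1.
Proof.
move=> u0 uV; exists (fun=> u) => v; have [c vE] := uV v.
exists (\row_(_ < 1) c); split=> [|d]; first by rewrite big_ord1 mxE.
rewrite big_ord1 vE => cd; apply/rowP => i; rewrite mxE ord1.
by have /(congr1 (fun w => w - d 0 0 *: u)) := cd; rewrite subrr -scalerBl =>
  /eqP; rewrite scaler_eq0 (negPf u0) orbF subr_eq0 => /eqP.
Qed.

(** * Algebras that are fields *)

Record is_field_algebra (K : fieldType) (Q : nualgType K) (e : Q) : Prop := {
  fieldalgC : commutative (@nmul K Q);
  fieldalg1 : left_id e nmul;
  fieldalg_neq0 : e != 0;
  fieldalgV : forall x : Q, x != 0 -> exists y, y ** x = e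
}.

Section FieldOfAlgebra.
Variables (K : fieldType) (Q : nualgType K) (e : Q) (h : is_field_algebra e).

(** The proof [h] is kept as a parameter of the type, because the field
structure put on the underlying algebra depends on it. *)
Definition field_of : Type := let _ := h in Q.

HB.instance Definition _ := GRing.Zmodule.on field_of.

HB.instance Definition _ := GRing.Zmodule_isComNzRing.Build field_of
  (@nmulA K Q) (fieldalgC h) (fieldalg1 h) (@nmulDl K Q) (fieldalg_neq0 h).

Definition field_of_inv (x : field_of) : field_of :=
  if x == 0 then 0 else xget 0 [set y : field_of | y * x = 1].

Fact field_of_mulVf x : x != 0 -> field_of_inv x * x = 1.
Proof.
move=> x0; rewrite /field_of_inv (negPf x0).
by case: xgetP => // no_y; have [y yx] := fieldalgV h x0; case: (no_y y).
Qed.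

Fact field_of_inv0 : field_of_inv 0 = 0.
Proof. by rewrite /field_of_inv eqxx. Qed.

HB.instance Definition _ := GRing.ComNzRing_isField.Build field_of
  field_of_mulVf field_of_inv0.

Definition scalar_of (c : K) : field_of := (c *: e : Q).

Fact scalar_of_additive : zmod_morphism scalar_of.
Proof. by move=> c d; exact: scalerBl. Qed.

Fact scalar_of_multiplicative : monoid_morphism scalar_of.
Proof.
split=> [|c d]; first exact: scale1r.
rewrite /scalar_of -[RHS]/((c *: e : Q) ** (d *: e)).
by rewrite nmulZl nmulZr (fieldalg1 h) scalerA.
Qed.

HB.instance Definition _ :=
  GRing.isZmodMorphism.Build K field_of scalar_of scalar_of_additive.
HB.instance Definition _ :=
  GRing.isMonoidMorphism.Build K field_of scalar_of scalar_of_multiplicative.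

End FieldOfAlgebra.

(** * Maximal ideals of commutative algebras *)

Section Maximal.
Variables (K : fieldType) (A : comNualgType K) (M : algIdeal A).
Hypothesis Mmax : maximal_ideal M.

(** Maximality for ideals given as sets; commutativity reduces two-sidedness to
one side. *)
Lemma maximal_absorbs (P : set A) :
  P 0 -> (forall a b, P a -> P b -> P (a + b)) ->
  (forall c a, P a -> P (c *: a)) -> (forall a b, P b -> P (a ** b)) ->
  (forall a, a \in M -> P a) -> (exists2 a, P a & a \notin M) -> forall a, P a.
Proof.
move=> P0 PD PZ Pl MP [a Pa Ma] b.
have [|I IP] := ideal_of_set P0 PD PZ Pl; first by move=> x y /(Pl x); rewrite nmulC.
have [|IM|IT] := Mmax.2 I; first by rewrite IP => x; exact: MP.
  by move/negP: Ma; case; suff: [set` M] a by []; rewrite -IM IP.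
by rewrite -IP IT.
Qed.

Lemma maximal_proper : exists a, a \notin M.
Proof.
apply: contrapT => no_a; move/eqP: Mmax.1; apply; apply/seteqP; split=> // a _.
by apply: contrapT => Ma; apply: no_a; exists a; exact/negP.
Qed.

(** When all products lie in [M], the subspace spanned by [M] and one vector [u]
outside it is already an ideal, so it is everything. *)
Lemma square_codim1 : alg_square A `<=` [set` M] -> has_codim M 1.
Proof.
move=> sqM; have [u Mu] := maximal_proper.
have prodM a b : a ** b \in M.
  apply: sqM; exists 1%N, (fun=> 1), (fun=> a ** b); split=> [_|].
    by exists a, b.
  by rewrite big_ord1 scale1r.
have allP := @maximal_absorbs [set a | exists c, a - c *: u \in M].
have {}allP a : exists c, a - c *: u \in M.
  apply: allP a.
  - by exists 0; rewrite scale0r subr0; exact: ideal0.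
  - move=> a b [c ac] [d bd]; exists (c + d).
    by rewrite scalerDl opprD addrACA; exact: idealD.
  - by move=> c a [d ad]; exists (c * d); rewrite -scalerA -scalerBr; exact: idealZ.
  - by move=> a b _; exists 0; rewrite scale0r subr0.
  - by move=> a Ma; exists 0; rewrite scale0r subr0.
  - by exists u => //; exists 1; rewrite scale1r subrr; exact: ideal0.
apply: (@has_dim1 _ _ (qproj M u)); first by apply: contraNneq Mu => /qproj_eq0.
move=> q; have [a <-] := qproj_surj q; have [c ac] := allP a.
by exists c; rewrite -qprojZ; apply/qproj_eq.
Qed.

Hypothesis sqM : ~ (alg_square A `<=` [set` M]).

(** The [a] that multiply [A] into [M] form an ideal containing [M].  Were it all
of [A], every product, hence [alg_square A], would lie in [M]. *)
Lemma square_annihilator a : (forall b, a ** b \in M) -> a \in M.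
Proof.
move=> Ma; apply: contrapT => Na; apply: sqM => _ [n [c [s [sP ->]]]].
have allP : forall a b, a ** b \in M.
  apply: (@maximal_absorbs [set a | forall b, a ** b \in M]) => /=.
  - by move=> b; rewrite nmulC nmul0; exact: ideal0.
  - by move=> x y xM yM b; rewrite nmulDl; exact: idealD.
  - by move=> d x xM b; rewrite nmulZl; exact: idealZ.
  - by move=> x y yM b; rewrite -nmulA; exact: idealMl.
  - by move=> x xM b; exact: idealMr.
  - by exists a => //; exact/negP.
apply: (big_ind (fun x => x \in M)) => [||i _]; first exact: ideal0.
  exact: idealD.
by apply: idealZ; have [x [y ->]] := sP i.
Qed.

(** The ideal [a ** A + M] contains a product [a ** b] outside [M], by
[square_annihilator]. *)
Lemma maximal_division a x : a \notin M -> exists c, x - a ** c \in M.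
Proof.
move=> Na; have [b ab] : exists b, a ** b \notin M.
  apply: contrapT => no_b; move/negP: Na; apply; apply: square_annihilator => b.
  by apply: contrapT => /negP ab; apply: no_b; exists b.
move: x; apply: (@maximal_absorbs [set x | exists c, x - a ** c \in M]) => /=.
- by exists 0; rewrite nmul0 subr0; exact: ideal0.
- move=> x y [c xc] [d yd]; exists (c + d).
  by rewrite nmulDr opprD addrACA; exact: idealD.
- by move=> d x [c xc]; exists (d *: c); rewrite nmulZr -scalerBr; exact: idealZ.
- move=> y x [c xc]; exists (y ** c).
  by rewrite nmulA (nmulC a) -nmulA -nmulBr; exact: idealMl.
- by move=> x Mx; exists 0; rewrite nmul0 subr0.
- by exists (a ** b) => //; exists b; rewrite subrr; exact: ideal0.
Qed.

(** Dividing [a] by itself gives [e] with [a ** e = a] modulo [M].  This [e] is an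
identity on all of [A / M] since every class is a multiple of that of [a]. *)
Lemma maximal_quotient_field : exists e : alg_quot M, is_field_algebra e.
Proof.
have mulC : commutative (@nmul K (alg_quot M)).
  move=> p q; have [a <-] := qproj_surj p; have [b <-] := qproj_surj q.
  by rewrite -!qprojM nmulC.
have [a Na] := maximal_proper; have [e /qproj_eq ae] := maximal_division a Na.
have e1 : left_id (qproj M e) nmul.
  move=> q; have [x <-] := qproj_surj q; have [c /qproj_eq ->] := maximal_division x Na.
  by rewrite qprojM nmulA (mulC (qproj M e)) -(qprojM M a e) -ae.
exists (qproj M e); split=> // [|q q0].
  apply: contraNneq Na => e0; apply/qproj_eq0.
  by rewrite -[LHS]e1 e0 mulC nmul0.
have [x xq] := qproj_surj q; have Nx : x \notin M.
  by apply: contraNN q0 => Mx; rewrite -xq; apply/eqP/qproj_eq0.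
have [c /qproj_eq ec] := maximal_division e Nx.
by exists (qproj M c); rewrite -xq mulC -qprojM ec.
Qed.

End Maximal.

(** * The norm of a Banach algebra as a real number *)

Section Banach.
Variables (R : realType) (A : comBanachAlgType R[i]).
Implicit Types (x y : A).

(** The norm of [A] takes its values in [R[i]]; its real part loses nothing
([rnormE]) and makes order and infimum of [R] available. *)
Definition rnorm x : R := complex.Re `|x|.

Lemma rnormE x : `|x| = (rnorm x)%:C.
Proof. by rewrite /rnorm RRe_real // normr_real. Qed.

Lemma rnorm_ge0 x : 0 <= rnorm x.
Proof. rewrite -lecR -rnormE; exact: normr_ge0. Qed.

Lemma rnormD x y : rnorm (x + y) <= rnorm x + rnorm y.
Proof. by rewrite -lecR rmorphD /= -!rnormE ler_normD. Qed.

Lemma rnormM x y : rnorm (x ** y) <= rnorm x * rnorm y.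
Proof. by rewrite -lecR rmorphM /= -!rnormE norm_nmul_le. Qed.

Lemma rnormZ c x : rnorm (c *: x) = normc c * rnorm x.
Proof. by apply: complexI; rewrite rmorphM /= -!rnormE normrZ. Qed.

Lemma rnormN x : rnorm (- x) = rnorm x.
Proof. by rewrite /rnorm normrN. Qed.

Lemma rnorm_eq0 x : rnorm x = 0 -> x = 0.
Proof. by move=> x0; apply/eqP; rewrite -normr_eq0 rnormE x0. Qed.

(** The solution is the sum of [x + x^2 + x^3 + ...], which converges because
[A] is complete.  In the unitization it says that [1 - x] is invertible with
inverse [1 + y]. *)
Lemma quasi_inverse x : rnorm x < 1 -> exists y, y = x + x ** y.
Proof.
move=> x1; have x0 := rnorm_ge0 x.
pose p n := iter n (nmul x) x.
have p_le n : rnorm (p n) <= rnorm x * rnorm x ^+ n.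
  elim: n => [|n IH]; first by rewrite expr0 mulr1.
  by apply: le_trans (rnormM _ _) _; rewrite exprS ler_wpM2l.
have /cauchy_cvgP/cvg_ex[l lP] : cauchy (series p @ \oo).
  apply/cauchy_seriesP => e e0.
  have eE : e = (complex.Re e)%:C by rewrite RRe_real // gtr0_real.
  have {}e0 : 0 < complex.Re e by rewrite -ltcR -eE.
  have : cvgn (series (geometric (rnorm x) (rnorm x))).
    by apply: is_cvg_geometric_series; rewrite ger0_norm.
  move=> /cauchy_cvgP/cauchy_seriesP/(_ _ e0); apply: filterS => -[m n] /= lt_e.
  rewrite rnormE eE ltcR; apply: le_lt_trans lt_e.
  apply: le_trans (ler_norm _).
  rewrite -lecR -rnormE; apply: le_trans (ler_norm_sum _ _ _) _.
  rewrite rmorph_sum /=; apply: ler_sum => k _.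
  by rewrite rnormE lecR.
(* The partial sums satisfy [s n.+1 = x + x ** s n]; pass to the limit. *)
exists l; apply/eqP; rewrite -subr_eq0; apply/eqP/rnorm_eq0.
apply/eqP; rewrite eq_le rnorm_ge0 andbT; apply/ler_addgt0Pr => e e0.
have e20 : 0 < (e / 2)%:C by rewrite ltcR divr_gt0.
have /cvgrPdist_le/(_ _ e20)[N _ NP] := lP.
pose s n := \sum_(0 <= k < n) p k.
have {}NP n : (N <= n)%N -> rnorm (l - s n) <= e / 2.
  by move=> /NP /=; rewrite rnormE lecR.
have sS n : s n.+1 = s n + p n by rewrite /s big_nat_recr.
have sE n : s n.+1 = x + x ** s n.
  elim: n => [|n IH]; first by rewrite /s big_nat1 big_geq // nmul0 addr0.
  by rewrite sS {1}IH [in RHS]sS nmulDr -addrA; congr (_ + _).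
have := NP N (leqnn N); have := NP N.+1 (leqnSn N); rewrite sE => l1 l2.
have -> : l - (x + x ** l) = (l - (x + x ** s N)) - x ** (l - s N).
  by rewrite nmulBr opprB !opprD !addrA subrK.
apply: le_trans (rnormD _ _) _; rewrite rnormN.
have := rnormM x (l - s N).
have := ler_wpM2r (rnorm_ge0 (l - s N)) (ltW x1); lra.
Qed.

End Banach.

(** * The quotient seminorm *)

Section QuotientSeminorm.
Variables (R : realType) (A : comBanachAlgType R[i]) (M : algIdeal A).
Implicit Types (x y : A) (p q : alg_quot M).

Definition quot_norm q : R := inf [set rnorm x | x in [set x | qproj M x = q]].

Let lift_norms_has_inf q : has_inf [set rnorm x | x in [set x | qproj M x = q]].
Proof.
split; last by exists 0 => _ [x _ <-]; exact: rnorm_ge0.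
by have [x xq] := qproj_surj q; exists (rnorm x), x.
Qed.

Lemma quot_norm_le x : quot_norm (qproj M x) <= rnorm x.
Proof. by apply: ge_inf; [exact: (lift_norms_has_inf _).2 | exists x]. Qed.

Lemma le_quot_norm q r :
  (forall x, qproj M x = q -> r <= rnorm x) -> r <= quot_norm q.
Proof.
move=> r_le; apply: lb_le_inf; first exact: (lift_norms_has_inf q).1.
by move=> _ [x xq <-]; exact: r_le.
Qed.

Lemma quot_norm_ge0 q : 0 <= quot_norm q.
Proof. by apply: le_quot_norm => x _; exact: rnorm_ge0. Qed.

Lemma quot_norm_lift q (e : R) : 0 < e ->
  exists2 x, qproj M x = q & rnorm x <= quot_norm q + e.
Proof.
move=> e0; have [_ [x xq <-] /ltW x_le] := inf_adherent e0 (lift_norms_has_inf q).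
by exists x.
Qed.

Lemma quot_normD p q : quot_norm (p + q) <= quot_norm p + quot_norm q.
Proof.
apply/ler_addgt0Pr => e e0; have e20 : 0 < e / 2 by rewrite divr_gt0.
have [x <- x_le] := quot_norm_lift p e20.
have [y <- y_le] := quot_norm_lift q e20.
rewrite -qprojD; have := quot_norm_le (x + y); have := rnormD x y; lra.
Qed.

Lemma quot_normZ c q : quot_norm (c *: q) <= normc c * quot_norm q.
Proof.
have [->|c0] := eqVneq c 0.
  rewrite normc0 mul0r scale0r.
  have <- : qproj M 0 = 0 by apply/qproj_eq0; exact: ideal0.
  apply: le_trans (quot_norm_le _) _.
  by rewrite -(scale0r (0 : A)) rnormZ normc0 mul0r.
have nc0 : 0 < normc c.
  rewrite lt_def normc_ge0 andbT; apply: contraNneq c0 => /eq0_normc ->.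
  exact: eqxx.
rewrite -ler_pdivrMl //; apply: le_quot_norm => x xq.
by rewrite ler_pdivrMl // -xq -qprojZ -rnormZ quot_norm_le.
Qed.

(** Lifts are optimised one factor at a time: for a fixed lift [x] of [p], then over
all [x]. *)
Lemma quot_normM p q : quot_norm (p ** q) <= quot_norm p * quot_norm q.
Proof.
have qn0 := quot_norm_ge0.
(* The errors [e] are divided by the other factor plus [1], since that factor may
   vanish. *)
have step x : quot_norm (qproj M x ** q) <= rnorm x * quot_norm q.
  apply/ler_addgt0Pr => e e0.
  have d0 : 0 < e / (rnorm x + 1) by rewrite divr_gt0 // ltr_wpDl ?rnorm_ge0.
  have [y <- y_le] := quot_norm_lift q d0.
  rewrite -qprojM; apply: le_trans (quot_norm_le _) _.
  apply: le_trans (rnormM _ _) _.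
  apply: le_trans (ler_wpM2l (rnorm_ge0 x) y_le) _.
  rewrite mulrDr lerD2l mulrCA ler_piMr ?(ltW e0) //.
  by rewrite ler_pdivrMr ?mul1r ?lerDl // ltr_wpDl ?rnorm_ge0.
apply/ler_addgt0Pr => e e0.
have d0 : 0 < e / (quot_norm q + 1) by rewrite divr_gt0 // ltr_wpDl.
have [x <- x_le] := quot_norm_lift p d0.
apply: le_trans (step x) _.
apply: le_trans (ler_wpM2r (qn0 q) x_le) _.
rewrite mulrDl lerD2l mulrAC -mulrA ler_piMr ?(ltW e0) //.
by rewrite ler_pdivrMr ?mul1r ?lerDl // ltr_wpDl.
Qed.

(** If a lift [x] of the identity [u] had norm less than [1], projecting
[y = x + x ** y] to the quotient would leave [u = 0]. *)
Lemma quot_norm_unit_ge1 (u : alg_quot M) :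
  left_id u nmul -> u != 0 -> 1 <= quot_norm u.
Proof.
move=> u1 u0; apply: le_quot_norm => x xu; rewrite leNgt.
apply: contraNN u0 => /quasi_inverse[y yE].
have /(congr1 (fun v => v - qproj M y)) := congr1 (qproj M) yE.
by rewrite qprojD qprojM xu u1 subrr addrK => <-.
Qed.

Lemma quot_algebra_seminorm (u : alg_quot M) (h : is_field_algebra u) :
  @algebra_seminorm R (field_of h) (scalar_of h) quot_norm.
Proof.
split.
- exact: quot_norm_ge0.
- exact: quot_normD.
- exact: quot_normM.
- move=> c x; have -> : scalar_of h c * x = c *: (x : alg_quot M).
    rewrite -[LHS]/((c *: u) ** (x : alg_quot M)).
    by rewrite nmulZl (fieldalg1 h).
  exact: quot_normZ.
- apply: lt_le_trans ltr01 _.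
  exact: quot_norm_unit_ge1 (fieldalg1 h) (fieldalg_neq0 h).
Qed.

Lemma quot_scalar (u : alg_quot M) : is_field_algebra u ->
  forall q, exists c : R[i], q = c *: u.
Proof.
by move=> h q; have [c qE] := gelfand_mazur (quot_algebra_seminorm h) q; exists c.
Qed.

End QuotientSeminorm.

Lemma scalar_algebra_isomorphic (K : fieldType) (Q : nualgType K) (u : Q) :
  left_id u nmul -> u != 0 -> (forall q, exists c : K, q = c *: u) ->
  alg_isomorphic Q K^o.
Proof.
move=> u1 u0 uQ.
have /choice[f fP] := uQ.
have uI : injective (fun c : K => c *: u).
  move=> c d /eqP; rewrite -subr_eq0 -scalerBl scaler_eq0 (negPf u0) orbF.
  by rewrite subr_eq0 => /eqP.
have f_lin : linear (f : Q -> K^o).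
  move=> c p q; apply: uI; rewrite -fP scalerDl -[c *: (f p : K^o)]/(c * f p).
  by rewrite -scalerA -!fP.
have f_mul : {morph (f : Q -> K^o) : p q / p ** q}.
  move=> p q; apply: uI; rewrite -fP -[(f p : K^o) ** f q]/(f p * f q).
  by rewrite [in LHS](fP p) nmulZl [in LHS](fP q) nmulZr u1 scalerA.
pose g : {linear Q -> K^o} := HB.pack (f : Q -> K^o) (GRing.isLinear.Build K Q K^o _ f f_lin).
exists g; split; first exact: f_mul.
exists (fun c => c *: u) => [q|c]; first by rewrite /= -fP.
by apply: uI; rewrite /= -fP.
Qed.

Theorem theorem3p3 (R : realType) (A : comBanachAlgType R[i]) :
  (forall M : algIdeal A, maximal_ideal M -> has_codim M 1) /\
  (forall M : algIdeal A, maximal_ideal M ->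
     alg_isomorphic (alg_quot M) R[i]^o \/ alg_square A `<=` [set` M]).
Proof.
split=> M Mmax; have [sqM|sqM] := pselect (alg_square A `<=` [set` M]).
- exact: square_codim1.
- have [u h] := maximal_quotient_field Mmax sqM.
  exact: has_dim1 (fieldalg_neq0 h) (quot_scalar h).
- by right.
- have [u h] := maximal_quotient_field Mmax sqM; left.
  exact: scalar_algebra_isomorphic (fieldalg1 h) (fieldalg_neq0 h) (quot_scalar h).
Qed.
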